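(* Let $\epsilon\in(0,1)$ and let $\mathbf A\in\{-1,0,1\}^{n\times n}$ be positive semidefinite with eigenvalues $\lambda_1\ge\cdots\ge\lambda_p>0$ and $\lambda_{p+1}=\cdots=\lambda_n=0$. Write $\mathbf A=\sum_{i=1}^p\mathbf v_i\mathbf v_i^T$ where $\mathbf v_1,\dots,\mathbf v_p\in\{-1,0,1\}^n$ have pairwise disjoint supports, and let $S_i=\{j:\mathbf v_i(j)\neq0\}$, so that $|S_i|=\lambda_i$. Let $G$ be an $(\epsilon/6)\cdot n$-expanding graph on vertex set $[n]$ with adjacency matrix $\mathbf B_G$. Let $\mathbf A_G$ be the binary matrix with $(\mathbf A_G)_{ij}=1$ whenever $(\mathbf B_G)_{ij}=1$ and $|\mathbf A_{ij}|=1$, and $(\mathbf A_G)_{ij}=0$ otherwise, and let $\bar G$ be the graph with adjacency matrix $\mathbf A_G$. Let $\bar G_{S_i}$ be the induced subgraph of $\bar G$ on $S_i$, and let $C_i\subseteq[n]$ be the largest connected component of $\bar G_{S_i}$. Then $$\lambda_i-\frac{\epsilon}{2}n<|C_i|\le\lambda_i.$$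
   Context: For $\delta>0$, a $\delta$-expanding graph (a $\delta$-expander) on $n$ vertices is an undirected graph such that any two disjoint vertex subsets each containing at least $\delta$ vertices are joined by at least one edge. (Such a decomposition $\mathbf A=\sum_i\mathbf v_i\mathbf v_i^T$ with disjointly supported $\{-1,0,1\}$-vectors and $|S_i|=\lambda_i$ always exists for PSD $\mathbf A\in\{-1,0,1\}^{n\times n}$.) *)

(* Defs.v *)
From mathcomp Require Export all_boot all_order all_algebra.

Set Implicit Arguments.
Unset Strict Implicit.
Unset Printing Implicit Defensive.

Import Order.TTheory GRing.Theory Num.Theory.
Local Open Scope ring_scope.

Section Matrices.
Variable R : numDomainType.

Definition sign01 : {pred R} := [pred x | x \in [:: -1; 0; 1]].

Definition psd n (A : 'M[R]_n) : Prop :=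
  A^T = A /\ forall x : 'cV[R]_n, 0 <= (x^T *m A *m x) 0 0.

(* [lam] lists the eigenvalues of [A] in nonincreasing order, repeated
   according to algebraic multiplicity; over a real field this says in
   particular that all the eigenvalues are in [R]. *)
Definition ordered_spectrum n (A : 'M[R]_n) (lam : n.-tuple R) : Prop :=
  char_poly A = \prod_(l <- lam) ('X - l%:P) /\ sorted >=%R lam.

Definition vsupp n (v : 'cV[R]_n) : {set 'I_n} := [set j | v j 0 != 0].

(* A graph on the vertex set 'I_n is given by its adjacency relation. *)
Definition adjmx n (e : rel 'I_n) : 'M[R]_n := \matrix_(i, j) (e i j)%:R.

Definition graph_of_adjmx n (B : 'M[R]_n) : rel 'I_n :=
  [rel i j | B i j == 1].

(* Undirected means symmetric; self-loops are neither required nor excluded. *)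
Definition expander n (delta : R) (e : rel 'I_n) : Prop :=
  symmetric e /\
  forall X Y : {set 'I_n}, [disjoint X & Y] ->
    delta <= #|X|%:R -> delta <= #|Y|%:R ->
    exists x y, [/\ x \in X, y \in Y & e x y].

Definition masked_adjmx n (A B : 'M[R]_n) : 'M[R]_n :=
  \matrix_(i, j) (if (B i j == 1) && (`|A i j| == 1) then 1 else 0).

End Matrices.

Section Graphs.
Variable T : finType.

(* The induced subgraph on [S] is kept as a relation on the ambient type, with
   no edge touching the complement of [S]; its vertex set [S] must be supplied
   separately when taking components. *)
Definition induced (e : rel T) (S : {set T}) : rel T := [rel x y in S | e x y].

Definition components (e : rel T) (S : {set T}) : {set {set T}} :=
  equivalence_partition (connect (induced e S)) S.

(* Ties are allowed: any component of maximum cardinality qualifies. *)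
Definition largest_component (e : rel T) (S C : {set T}) : Prop :=
  C \in components e S /\ forall D, D \in components e S -> (#|D| <= #|C|)%N.

End Graphs.

(* Main.v *)
(* On [S = S_i] every entry of [A] has absolute value 1, so the masked graph and
   [G] have the same edges inside [S].  Put [d = eps n / 6]: by expansion, no
   union [U] of components of [S] satisfies both [d <= |U|] and
   [d <= |S \ U|].  Suppose [|C| <= |S| - 3 d].  If [d <= |C|], then [U = C]
   is forbidden.  Otherwise every component is smaller than [d]; adding one more
   component to a largest union of size less than [d] gives a union whose size
   lies in [d, 2 d), which is forbidden too. *)
Require Import Defs.
From mathcomp Require Import all_boot all_order all_algebra.
From mathcomp Require Import ring lra.
Import Order.TTheory GRing.Theory Num.Theory.
Local Open Scope ring_scope.

Set Implicit Arguments.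
Unset Strict Implicit.
Unset Printing Implicit Defensive.

Section Components.
Variables (T : finType) (e : rel T) (S : {set T}).

(* For a relation that is not symmetric this is only closure under out-edges;
   the proofs need no more. *)
Definition union_of_components (U : {set T}) : bool :=
  (U \subset S) && [forall x in U, forall y, induced e S x y ==> (y \in U)].

Lemma union_of_componentsP (U : {set T}) :
  reflect (U \subset S /\ forall x y, x \in U -> induced e S x y -> y \in U)
          (union_of_components U).
Proof.
apply: (iffP andP) => -[US Uclosed]; split=> //.
  by move=> x y xU; move/forall_inP: Uclosed => /(_ x xU)/forallP/(_ y)/implyP.
by apply/forall_inP => x xU; apply/forallP => y; apply/implyP; apply: Uclosed.
Qed.

Lemma union_of_components0 : union_of_components set0.
Proof.
by apply/union_of_componentsP; split=> [|x y]; rewrite ?sub0set ?inE.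
Qed.

Lemma union_of_componentsU (U V : {set T}) :
  union_of_components U -> union_of_components V ->
  union_of_components (U :|: V).
Proof.
move=> /union_of_componentsP[US Ucl] /union_of_componentsP[VS Vcl].
apply/union_of_componentsP; split=> [|x y]; first by rewrite subUset US VS.
rewrite !inE => /orP[xU|xV] exy; apply/orP.
  by left; apply: Ucl exy.
by right; apply: Vcl exy.
Qed.

Lemma component_union_of_components (D : {set T}) :
  D \in components e S -> union_of_components D.
Proof.
move=> /imsetP[x xS ->]; apply/union_of_componentsP.
split=> [|y z]; first by apply/subsetP => y; rewrite inE => /andP[].
rewrite !inE => /andP[yS cxy] eyz; case/andP: (eyz) => /andP[_ zS] _.
by rewrite zS (connect_trans cxy (connect1 eyz)).
Qed.

Lemma component_cover (x : T) :
  x \in S -> exists2 D, D \in components e S & x \in D.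
Proof.
move=> xS; exists [set y in S | connect (induced e S) x y].
  exact: imset_f.
by rewrite inE xS connect0.
Qed.

(** Expansion is assumed only between subsets of [S], because the masked graph is guaranteed to keep
    the edges of [G] only inside a single support. *)
Lemma largest_component_gt (R : realDomainType) (d : R) (C : {set T}) :
    0 < d ->
    (forall X Y : {set T}, X \subset S -> Y \subset S -> [disjoint X & Y] ->
       d <= #|X|%:R -> d <= #|Y|%:R -> exists x y, [/\ x \in X, y \in Y & e x y]) ->
    largest_component e S C ->
  #|S|%:R - 3 * d < #|C|%:R.
Proof.
move=> d_gt0 expS [Ccomp Cmax]; rewrite ltNge; apply/negP => Csmall.
(* Otherwise [S :\: U] also has size at least [d], and expansion gives an edge leaving [U], which is
   closed under the edges of [S]. *)
have no_cut U : union_of_components U -> d <= #|U|%:R -> #|S|%:R - d < #|U|%:R.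
  move=> /union_of_componentsP[US Ucl] dU; rewrite ltNge; apply/negP => Ule.
  have cardSU : #|S|%:R = #|U|%:R + #|S :\: U|%:R :> R.
    by rewrite -natrD -(cardsID U S) (setIidPr US).
  have [|//||x [y [xU]]] := expS U (S :\: U) US (subsetDl _ _).
  - by rewrite -setI_eq0 setIDA setIC -setIDA setDv setI0.
  - by move: cardSU Ule; clear; move: #|S|%:R #|U|%:R #|S :\: U|%:R => s u w; lra.
  rewrite inE => /andP[/negP yU yS] exy; apply: yU.
  by apply: (Ucl x) => //; rewrite /induced /= (subsetP US x xU) yS.
have Cd : #|C|%:R < d.
  rewrite ltNge; apply/negP => dC.
  have := no_cut _ (component_union_of_components Ccomp) dC.
  by move: Csmall d_gt0; clear; move: #|S|%:R #|C|%:R => s c; lra.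
pose small U := union_of_components U && (#|U|%:R < d).
have small0 : small set0 by rewrite /small union_of_components0 cards0.
have [U /andP[Uunion Ud] Umax] := arg_maxnP (fun U : {set T} => #|U|) small0.
(* Room remains outside [U]: [|S| >= |C| + 3 d >= 3 d > |U|]. *)
have /subsetPn[x xS xU] : ~~ (S \subset U).
  apply/negP => /subset_leq_card; rewrite -(ler_nat R) => SU.
  move: SU Ud Csmall d_gt0 (ler0n R #|C|).
  by clear; move: #|S|%:R #|U|%:R #|C|%:R => s u c; lra.
have [D Dcomp xD] := component_cover xS.
have UDunion := union_of_componentsU Uunion (component_union_of_components Dcomp).
have UD_gt : (#|U| < #|U :|: D|)%N.
  apply: proper_card; rewrite properE subsetUl; apply/subsetPn.
  by exists x; rewrite // inE xD orbT.
(* The component of [x] strictly enlarges [U], so by maximality of [U] the union can no longer be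
   small. *)
have dUD : d <= #|U :|: D|%:R.
  rewrite leNgt; apply/negP => UDd.
  have /Umax : small (U :|: D) by rewrite /small UDunion.
  by rewrite /= leqNgt UD_gt.
have UDle : #|U :|: D|%:R <= #|U|%:R + #|C|%:R :> R.
  rewrite -natrD ler_nat (leq_trans _ (leq_add (leqnn _) (Cmax D Dcomp))) //.
  by rewrite cardsU leq_subr.
(* Since [|U|] and [|C|] are below [d], the union has size below [2 d], whereas [no_cut] makes it
   larger than [|S| - d >= 2 d]. *)
move: (no_cut _ UDunion dUD) UDle Ud Csmall d_gt0.
by clear; move: #|S|%:R #|U|%:R #|C|%:R #|U :|: D|%:R => s u c ud; lra.
Qed.

End Components.

Lemma norm_sign01 (R : numDomainType) (x : R) :
  x \in @sign01 R -> x != 0 -> `|x| = 1.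
Proof. by rewrite !inE => /or3P[]/eqP->; rewrite ?eqxx ?normrN1 ?normr1. Qed.

(** Disjointness of the supports kills every term except that of index [i], which is a product of
    two signs. *)
Lemma disjoint_sum_outer_norm (R : numDomainType) (n p : nat)
    (v : 'I_p -> 'cV[R]_n) (i : 'I_p) (x y : 'I_n) :
    (forall i j, v i j 0 \in @sign01 R) ->
    (forall i i', i != i' -> [disjoint vsupp (v i) & vsupp (v i')]) ->
    x \in vsupp (v i) -> y \in vsupp (v i) ->
  `|(\sum_(k < p) v k *m (v k)^T) x y| = 1.
Proof.
move=> v01 vdisj xi yi.
have outerE k : (v k *m (v k)^T) x y = v k x 0 * v k y 0.
  by rewrite mxE big_ord1 mxE.
rewrite summxE (bigD1 i) //= big1 => [|k ki].
  by rewrite addr0 outerE normrM !norm_sign01 ?mulr1 //; move: xi yi; rewrite !inE.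
rewrite outerE; suff /eqP-> : v k x 0 == 0 by rewrite mul0r.
by have := disjointFl (vdisj _ _ ki) xi; rewrite inE => /negbFE.
Qed.

Theorem theorem13 (R : rcfType) (n p : nat) (eps : R)
    (A : 'M[R]_n) (lam : n.-tuple R) (v : 'I_p -> 'cV[R]_n) (G : rel 'I_n)
    (heps : 0 < eps < 1)
    (hA01 : forall i j, A i j \in @sign01 R)
    (hApsd : psd A)
    (hlam : ordered_spectrum A lam)
    (hp : (p <= n)%N)
    (hlam_pos : forall k : nat, (k < p)%N -> 0 < lam`_k)
    (hlam_zero : forall k : nat, (p <= k < n)%N -> lam`_k = 0)
    (hv01 : forall (i : 'I_p) (j : 'I_n), v i j 0 \in @sign01 R)
    (hvdisj : forall i i' : 'I_p, i != i' -> [disjoint vsupp (v i) & vsupp (v i')])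
    (hAv : A = \sum_(i < p) v i *m (v i)^T)
    (hS : forall i : 'I_p, #|vsupp (v i)|%:R = lam`_i)
    (hG : expander (eps / 6 * n%:R) G) :
  let AG := masked_adjmx A (adjmx R G) in
  let Gbar := graph_of_adjmx AG in
  forall (i : 'I_p) (C : {set 'I_n}),
    largest_component Gbar (vsupp (v i)) C ->
    lam`_i - eps / 2 * n%:R < #|C|%:R <= lam`_i.
Proof.
move=> AG Gbar i C Clargest.
case/andP: heps => eps_gt0 _; case: hG => _ Gexp.
(* The index [i] itself witnesses [0 < p]; positivity of [n] makes the expansion threshold
   positive. *)
have n_gt0 : (0 < n)%N by apply: leq_trans hp; apply: leq_ltn_trans (ltn_ord i).
have d_gt0 : 0 < eps / 6 * n%:R by rewrite mulr_gt0 ?divr_gt0 ?ltr0n.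
have GbarE x y :
    x \in vsupp (v i) -> y \in vsupp (v i) -> G x y -> Gbar x y.
  move=> xS yS Gxy; rewrite /Gbar /graph_of_adjmx /AG /= !mxE Gxy eqxx hAv.
  by rewrite (disjoint_sum_outer_norm hv01 hvdisj xS yS) eqxx.
rewrite -hS; apply/andP; split; last first.
  rewrite ler_nat; apply: subset_leq_card.
  by have /union_of_componentsP[] := component_union_of_components Clargest.1.
(* The threshold [eps / 6] is chosen so that a loss of three thresholds is exactly [eps / 2 * n]. *)
have -> : eps / 2 * n%:R = 3 * (eps / 6 * n%:R) by field.
apply: (largest_component_gt d_gt0) Clargest => X Y XS YS XY dX dY.
have [x [y [xX yY Gxy]]] := Gexp X Y XY dX dY.
exists x, y; split=> //; apply: GbarE Gxy; first exact: (subsetP XS).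
exact: (subsetP YS).
Qed.
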